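(* Let $\Gamma$ be an $R$-thin connected non-bipartite graph. (a) $(\Gamma, K_2)$ is unstable if and only if $(\Gamma, C_{2k})$ is unstable for every integer $k \geq 2$. (b) If $k \ge 3$ is an integer such that $2k$ is compatible with $\Gamma$, then $(\Gamma, C_{2k})$ is nontrivially unstable if and only if $(\Gamma, K_2)$ is unstable. (c) If there exists an integer $k \ge 3$ such that $2k$ is compatible with $\Gamma$ and $(\Gamma, C_{2k})$ is nontrivially unstable, then $(\Gamma, C_{2l})$ is unstable for every integer $l \ge 3$.
   Context: All graphs are finite and undirected with no loops or parallel edges. $V(\Gamma)$, $E(\Gamma)$ are the vertex and edge sets, $N_\Gamma(u)$ is the neighbourhood of $u$, $\deg(u)=|N_\Gamma(u)|$, $\mathrm{Aut}(\Gamma)$ is the automorphism group, $K_2$ is the complete graph on two vertices, and $C_n$ is the cycle with $n\ge 3$ vertices. A graph is trivial if it has only one vertex and nontrivial otherwise. The direct product $\Gamma \times \Sigma$ has vertex set $V(\Gamma) \times V(\Sigma)$, with $(u,v)$ and $(x,y)$ adjacent if and only if $\{u,x\}\in E(\Gamma)$ and $\{v,y\}\in E(\Sigma)$. Two graphs $\Gamma,\Sigma$ are coprime if there is no nontrivial graph $\Delta$ such that $\Gamma \cong \Gamma' \times \Delta$ and $\Sigma \cong \Sigma' \times \Delta$ for some graphs $\Gamma', \Sigma'$. A graph $\Gamma$ is $R$-thin if $N_\Gamma(u) \ne N_\Gamma(v)$ for any two distinct vertices $u,v$. A graph pair $(\Gamma,\Sigma)$ is stable if $\mathrm{Aut}(\Gamma)\times\mathrm{Aut}(\Sigma)$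 is isomorphic to $\mathrm{Aut}(\Gamma\times\Sigma)$, and unstable otherwise. An unstable pair $(\Gamma,\Sigma)$ is nontrivially unstable if $\Gamma$ and $\Sigma$ are $R$-thin connected coprime graphs and at least one of them is non-bipartite. $\Gamma^*$ is the graph with vertex set $V(\Gamma)$ in which $u,v$ are adjacent if and only if $u \ne v$ and $\deg(u)=\deg(v)=2|N_\Gamma(u)\cap N_\Gamma(v)|$ (degrees in $\Gamma$). For $u\in V(\Gamma)$: if $u$ is isolated in $\Gamma^*$, $L(u)=\{0\}$; if $u$ has degree $1$ in $\Gamma^*$, $L(u)=\{0,1\}$; if $u$ has degree at least $2$ in $\Gamma^*$, $L(u)$ is the (possibly empty) set of lengths of the cycles of $\Gamma^*$ containing $u$. An integer $n\ge3$ is compatible with $\Gamma$ if either (i) $n$ is odd and $n\notin L(u)$ for at least one $u\in V(\Gamma)$, or (ii) $n$ is even and $n/2\notin L(u)$ for at least one $u\in V(\Gamma)$. *)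

(* Defs.v *)
From mathcomp Require Import all_boot all_fingroup.

Set Implicit Arguments.
Unset Strict Implicit.
Unset Printing Implicit Defensive.

Record sgraph := SGraph {
  vertex :> finType;
  edge : rel vertex;
  edge_sym : symmetric edge;
  edge_irr : irreflexive edge
}.

Definition nbh (G : sgraph) (u : G) : {set G} := [set v | edge u v].

Definition deg (G : sgraph) (u : G) : nat := #|nbh u|.

Definition trivial_graph (G : sgraph) : bool := #|G| == 1.

Definition R_thin (G : sgraph) : Prop :=
  forall u v : G, u != v -> nbh u != nbh v.

Definition connected_graph (G : sgraph) : Prop :=
  0 < #|G| /\ forall u v : G, connect (@edge G) u v.

Definition bipartite (G : sgraph) : Prop :=
  exists f : G -> bool, forall u v : G, edge u v -> f u != f v.

Definition graph_iso (G H : sgraph) : Prop :=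
  exists2 f : G -> H, bijective f & forall u v : G, edge (f u) (f v) = edge u v.

Section DirectProduct.
Variables G H : sgraph.

Definition direct_edge : rel (G * H)%type :=
  fun p q => edge p.1 q.1 && edge p.2 q.2.

Lemma direct_edge_sym : symmetric direct_edge.
Proof. by move=> p q; rewrite /direct_edge edge_sym (edge_sym p.2). Qed.

Lemma direct_edge_irr : irreflexive direct_edge.
Proof. by move=> p; rewrite /direct_edge edge_irr. Qed.

Definition direct_product : sgraph := SGraph direct_edge_sym direct_edge_irr.
End DirectProduct.

(* The empty graph has an empty product with every graph, so it is never a
   common factor as soon as [G] or [H] has a vertex. *)
Definition coprime_graphs (G H : sgraph) : Prop :=
  ~ exists D : sgraph, [/\ ~~ trivial_graph D,
      exists G' : sgraph, graph_iso G (direct_product G' D)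
    & exists H' : sgraph, graph_iso H (direct_product H' D)].

Section CompleteGraph.
Variable n : nat.

Definition complete_edge : rel 'I_n := fun i j => i != j.

Lemma complete_edge_sym : symmetric complete_edge.
Proof. by move=> i j; rewrite /complete_edge eq_sym. Qed.

Lemma complete_edge_irr : irreflexive complete_edge.
Proof. by move=> i; rewrite /complete_edge eqxx. Qed.

Definition complete_graph : sgraph :=
  SGraph complete_edge_sym complete_edge_irr.
End CompleteGraph.

Definition K2 : sgraph := complete_graph 2.

Section CycleGraph.
Variable n : nat.

(* [ordS] is the cyclic successor modulo n.  The conjunct [i != j] is redundant
   for n >= 2; it only makes the definition total, by removing the loop at
   n = 1.  This is the n-cycle for n >= 3. *)
Definition cycle_edge : rel 'I_n :=
  fun i j => (i != j) && ((j == ordS i) || (i == ordS j)).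

Lemma cycle_edge_sym : symmetric cycle_edge.
Proof. by move=> i j; rewrite /cycle_edge eq_sym orbC. Qed.

Lemma cycle_edge_irr : irreflexive cycle_edge.
Proof. by move=> i; rewrite /cycle_edge eqxx. Qed.

Definition cycle_graph : sgraph := SGraph cycle_edge_sym cycle_edge_irr.
End CycleGraph.

Section Automorphisms.
Variable G : sgraph.

Definition graph_aut : {set {perm G}} :=
  [set s : {perm G} | [forall u, forall v, edge (s u) (s v) == edge u v]].

Lemma graph_autP (s : {perm G}) :
  reflect (forall u v, edge (s u) (s v) = edge u v) (s \in graph_aut).
Proof.
rewrite inE; apply: (iffP forallP) => [h u v|h u].
  by apply/eqP; move/forallP: (h u); apply.
by apply/forallP => v; rewrite h.
Qed.

Lemma graph_aut_group_set : group_set graph_aut.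
Proof.
apply/group_setP; split=> [|s t /graph_autP hs /graph_autP ht].
  by apply/graph_autP => u v; rewrite !perm1.
by apply/graph_autP => u v; rewrite !permM ht hs.
Qed.

Canonical graph_aut_group : {group {perm G}} := Group graph_aut_group_set.
End Automorphisms.

Definition stable (G H : sgraph) : bool :=
  (setX (graph_aut G) (graph_aut H) \isog graph_aut (direct_product G H))%g.

Definition unstable (G H : sgraph) : bool := ~~ stable G H.

Definition nontrivially_unstable (G H : sgraph) : Prop :=
  [/\ unstable G H,
      R_thin G /\ R_thin H,
      connected_graph G /\ connected_graph H,
      coprime_graphs G H
    & ~ bipartite G \/ ~ bipartite H].

Section Star.
Variable G : sgraph.

Definition star_edge : rel G := fun u v =>
  [&& u != v, deg u == deg v & deg v == 2 * #|nbh u :&: nbh v|].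

Lemma star_edge_sym : symmetric star_edge.
Proof.
move=> u v; rewrite /star_edge eq_sym (eq_sym (deg u)) (setIC (nbh u)).
by case: eqP => //= _; case: eqP => //= ->.
Qed.

Lemma star_edge_irr : irreflexive star_edge.
Proof. by move=> u; rewrite /star_edge eqxx. Qed.

Definition star_graph : sgraph := SGraph star_edge_sym star_edge_irr.

Definition in_cycle_of_length (H : sgraph) (u : H) (n : nat) : Prop :=
  exists c : seq H, [/\ 3 <= size c, ucycle (@edge H) c, u \in c & size c = n].

(* [inL u n] states that n belongs to the set L(u). *)
Definition inL (u : G) (n : nat) : Prop :=
  match @deg star_graph u with
  | 0 => n = 0
  | 1 => n = 0 \/ n = 1
  | _ => @in_cycle_of_length star_graph u n
  end.

Definition compatible (n : nat) : Prop :=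
  3 <= n /\
  ((odd n /\ exists u : G, ~ inL u n) \/
   (~~ odd n /\ exists u : G, ~ inL u n./2)).
End Star.

(* Main.v *)
Require Import Defs.
From mathcomp Require Import all_boot all_fingroup.

(** Automorphisms of the two factors always act on the product, so a pair is
    stable exactly when every automorphism of the product splits into a pair of
    automorphisms of the factors ([stableP]). Everything rests on one property
    of [G], [twofold_rigid]: permutations [a], [b] with [a u] adjacent to [b v]
    exactly when [u] is adjacent to [v] must coincide. A two-fold automorphism
    with [a] different from [b], applied over the two colour classes of a
    bipartite [H], gives an automorphism of [direct_product G H] that does not
    split ([stable_bipartite_rigid]). Conversely, if [G] is rigid, an
    automorphism of the product that acts on second coordinates by an
    automorphism of a connected [H] with an edge splits ([rigid_fibre_splits]).
    For [H = K2] this action always exists, because the bipartite double of a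
    connected non-bipartite [G] is connected; so [stable G K2] is equivalent to
    rigidity ([rigid_stable_K2]). This already shows that instability passes
    from [K2] to every even cycle.

    For the way back, let [C] be the cycle of length [2 * k] with [3 <= k]. As
    codegrees multiply in direct products, the starred graph of the product is
    the Cartesian product of [star_graph G] with the graph of steps of length 2
    on [C], two [k]-cycles ([star_product_edge]). An automorphism of the direct
    product preserves this starred graph together with the codegrees, and
    these yield a feature ([mixed]) of all two-edge paths that bend from one
    Cartesian factor to the other and of none inside a layer over a vertex. So
    the layer over a vertex, a [k]-cycle that never bends, goes to a [k]-cycle
    contained either in a layer over a vertex or in a copy of [star_graph G]. The second case is excluded
    when the image passes over a vertex [u0] on no [k]-cycle of [star_graph G]
    ([image_layer]), and some image does pass over [u0]. One layer mapped to a
    layer forces the same for all layers with the same symmetry of [C]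
    ([aut_splits]), since direct-product adjacency links neighbouring layers.
    Hence rigidity gives stability ([rigid_stable_cycle]).

    Compatibility of [2 * k] provides such a vertex [u0] ([compatible_even]),
    and so does any [k] larger than the number of vertices of [G]. The same
    vertex excludes a common factor of [G] and [C] ([coprime_cycle]). *)

Set Implicit Arguments.
Unset Strict Implicit.
Unset Printing Implicit Defensive.

(* Otherwise the name denotes the direct product of finite groups. *)
Local Notation direct_product := Defs.direct_product.

Lemma product_edgeE (G H : sgraph) (x y : direct_product G H) :
  edge x y = edge x.1 y.1 && edge x.2 y.2.
Proof. by []. Qed.

(** * Stability as splitting of automorphisms *)

Section Splitting.
Variables G H : sgraph.
Local Notation GH := (direct_product G H).

Definition splits (s : {perm GH}) : Prop :=
  exists ab : {perm G} * {perm H},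
    [/\ ab.1 \in graph_aut G, ab.2 \in graph_aut H
      & forall u i, s (u, i) = (ab.1 u, ab.2 i)].

Lemma pair_fun_inj (ab : {perm G} * {perm H}) :
  injective (fun x : GH => (ab.1 x.1, ab.2 x.2) : GH).
Proof. by move=> [u i] [v j] /= [/perm_inj -> /perm_inj ->]. Qed.

Definition pair_perm ab : {perm GH} := perm (@pair_fun_inj ab).

Lemma pair_permE ab u i : pair_perm ab (u, i) = (ab.1 u, ab.2 i).
Proof. by rewrite permE. Qed.

Lemma pair_permM :
  {in setX (graph_aut G) (graph_aut H) &, {morph pair_perm : x y / (x * y)%g}}.
Proof.
by move=> x y _ _; apply/permP => -[u i]; rewrite permM !pair_permE /= !permM.
Qed.

Canonical pair_perm_morphism := Morphism pair_permM.

(** Both groups have the same finite order exactly when the canonical embedding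
    of the first into the second is onto, so an abstract isomorphism already
    forces the canonical one. *)
Lemma stableP (u0 : G) (i0 : H) :
  stable G H <-> forall s, s \in graph_aut GH -> splits s.
Proof.
have inj : ('injm pair_perm_morphism)%g.
  apply/injmP => -[a b] [c d] _ _ /= /permP eq_ac.
  congr (_, _); apply/permP => x.
    by have := eq_ac (x, i0); rewrite !pair_permE => -[].
  by have := eq_ac (u0, x); rewrite !pair_permE => -[].
set AB := setX (graph_aut G) (graph_aut H).
have sub : (pair_perm_morphism @* AB)%g \subset graph_aut GH.
  apply/subsetP => _ /morphimP[[a b] _ /setXP[/graph_autP ha /graph_autP hb] ->].
  apply/graph_autP => -[u i] [v j]; rewrite !pair_permE.
  by rewrite !product_edgeE /= ha hb.
split=> [/card_isog eq_card s s_aut | split_all].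
  have /eqP im : (pair_perm_morphism @* AB)%g == graph_aut GH.
    by rewrite eqEcard sub /= card_injm // eq_card.
  rewrite -im in s_aut; case/morphimP: s_aut => -[a b] _ /setXP[ha hb] ->.
  by exists (a, b); split=> // u i; rewrite pair_permE.
apply/isogP; exists pair_perm_morphism => //.
apply/eqP; rewrite eqEsubset sub; apply/subsetP => s /split_all[[a b] [ha hb hs]].
have ab_in : (a, b) \in AB by rewrite inE ha hb.
apply/morphimP; exists (a, b) => //.
by apply/permP => -[u i]; rewrite hs pair_permE.
Qed.

End Splitting.

(** * Two-fold automorphisms *)

(** A pair [(a, b)] as in this definition is a two-fold automorphism; these
    pairs describe the automorphisms of [direct_product G K2] that fix both
    colour classes. *)
Definition twofold_rigid (G : sgraph) : Prop :=
  forall a b : {perm G}, (forall u v, edge (a u) (b v) = edge u v) -> a = b.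

Section TwoFold.
Variables G H : sgraph.
Local Notation GH := (direct_product G H).

(** A two-fold automorphism [(a, b)] yields an automorphism of the product that
    acts as [a] over one colour class of [H] and as [b] over the other; it can
    split only if [a = b]. *)
Lemma stable_bipartite_rigid (c : H -> bool) (i0 j0 : H) :
    (forall i j, edge i j -> c i != c j) -> edge i0 j0 ->
  stable G H -> twofold_rigid G.
Proof.
move=> col e0 stab a b ab; case: (pickP (mem [set: G])) => [u0 _|no]; last first.
  by apply/permP => u; have:= no u; rewrite !inE.
move/(stableP u0 i0): stab => stab.
pose f (x : GH) : GH := ((if c x.2 then a else b) x.1, x.2).
have f_inj : injective f.
  by move=> [u i] [v j] [/[swap] /= <- /perm_inj ->].
have /stab[[a' t] [_ _ sp]] : perm f_inj \in graph_aut GH.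
  apply/graph_autP => -[u i] [v j]; rewrite !permE !product_edgeE /=.
  case: (boolP (edge i j)) => [/col|]; last by rewrite !andbF.
  rewrite !andbT; case: (c i); case: (c j) => // _.
  by rewrite edge_sym ab edge_sym.
apply/permP => u; have := sp u i0; have := sp u j0; have := col _ _ e0.
by rewrite !permE /f /=; case: (c i0); case: (c j0) => // _ [-> _] [-> _].
Qed.

(** Over adjacent fibres [i] and [j] the automorphism induces a two-fold
    automorphism of [G], so rigidity makes it the same permutation over all
    fibres of a connected [H]. *)
Lemma rigid_fibre_splits (s : {perm GH}) (t : {perm H}) (i0 j0 : H) :
    twofold_rigid G -> connected_graph H -> edge i0 j0 ->
    s \in graph_aut GH -> t \in graph_aut H ->
    (forall u i, (s (u, i)).2 = t i) ->
  splits s.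
Proof.
move=> rigid [_ conn] e0 /graph_autP s_aut t_aut fib.
have sE u i : s (u, i) = ((s (u, i)).1, t i) by rewrite -(fib u) -surjective_pairing.
have a_inj i : injective (fun u => (s (u, i)).1).
  move=> u v eq_uv; suff [] : (u, i) = (v, i) :> GH by [].
  by apply: (@perm_inj _ s); rewrite sE [RHS]sE eq_uv.
pose a i := perm (@a_inj i).
have aE u i : a i u = (s (u, i)).1 by rewrite permE.
have twofold i j : edge i j -> forall u v, edge (a i u) (a j v) = edge u v.
  move=> eij u v; rewrite !aE; have := s_aut (u, i) (v, j).
  rewrite sE (sE v) !product_edgeE /=.
  by rewrite (graph_autP _ t_aut) eij !andbT.
have const i : a i = a i0.
  case/connectP: (conn i0 i) => p; elim: p (i0) => [|k p IH] l /=; first by move=> _ ->.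
  by case/andP=> e_lk pp last_i; rewrite (IH k) // (rigid _ _ (twofold _ _ e_lk)).
exists (a i0, t); split=> //= [|u i]; last by rewrite -(const i) aE -sE.
by apply/graph_autP => u v; rewrite -[RHS](twofold _ _ e0) (const j0).
Qed.

End TwoFold.

(** * Connectedness of the bipartite double *)

Section NonBipartite.
Variable G : sgraph.
Hypotheses (connG : connected_graph G) (nbipG : ~ bipartite G).

Lemma ex_neighbour (u : G) : exists v, edge u v.
Proof.
case: (pickP (edge u)) => [v e | iso_u]; first by exists v.
have all_u v : v = u.
  case: connG => _ /(_ u v) /connectP[[|w p] //= /andP[e _]].
  by rewrite iso_u in e.
case: nbipG; exists (fun _ => true) => v w.
by rewrite (all_u v) iso_u.
Qed.

Lemma deg_gt0 (u : G) : 0 < deg u.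
Proof. by case: (ex_neighbour u) => v e; apply/card_gt0P; exists v; rewrite inE. Qed.

(** The classical fact that the bipartite double of [G] is connected, as an
    induction principle: if some vertex had only one of the two signs, all
    would, and the sign would be a 2-colouring of [G]. *)
Lemma double_ind (Q : G -> bool -> bool) (u0 : G) (b0 : bool) :
    (forall u v b, edge u v -> Q u b -> Q v (~~ b)) -> Q u0 b0 ->
  forall u b, Q u b.
Proof.
move=> step Q0.
have walk u v : connect (@edge G) u v ->
    exists c : bool, forall b, Q u b -> Q v (b (+) c).
  case/connectP => p; elim: p u => [|w p IH] u /=.
    by move=> _ ->; exists false => b; rewrite addbF.
  case/andP=> e /IH{}IH /IH[c hc]; exists (~~ c) => b /(step _ _ _ e)/hc.
  by case: b; case: (c).
have conn u v : connect (@edge G) u v by case: connG.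
have some_sign u : Q u true || Q u false.
  by have [c /(_ _ Q0)] := walk _ _ (conn u0 u); case: (_ (+) _) => ->; rewrite ?orbT.
move=> u b; apply: contraT => nQ; case: nbipG; exists (fun v => Q v true).
have one_sign v : ~~ (Q v true && Q v false).
  apply: contra nQ => /andP[vt vf]; have [c hc] := walk _ _ (conn v u).
  have := hc _ vt; have := hc _ vf.
  by case: c b {hc} => -[].
move=> v w e; have := one_sign w; have := some_sign v.
have := step _ _ true e; have := step _ _ false e.
rewrite edge_sym in e; have := step _ _ true e; have := step _ _ false e => /=.
by case: (Q v true); case: (Q w true) => //=;
  case: (Q v false); case: (Q w false) => //=; do ?move=> /(_ isT).
Qed.

(** Whether an automorphism of [G x K2] moves a vertex to the other side is
    unchanged along edges, hence constant. *)
Lemma rigid_stable_K2 : twofold_rigid G -> stable G K2.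
Proof.
move=> rigid; case: (connG) => /card_gt0P[u0 _] _.
apply/(stableP u0 (ord0 : K2)) => s s_aut.
have K2E (i j : K2) : edge i j = (i != j) by [].
have K2P (i : K2) : i = ord0 \/ i = ord_max.
  by case: i => -[|[|//]] lt_i; [left|right]; apply: val_inj.
have K2eq (i j k : K2) : i != j -> i != k -> j = k.
  by case: (K2P i) => ->; case: (K2P j) => ->; case: (K2P k) => ->.
pose i0 : K2 := ord0; pose i1 : K2 := ord_max.
have t_aut (t : {perm K2}) : t \in graph_aut K2.
  by apply/graph_autP => i j; rewrite !K2E (inj_eq perm_inj).
pose c (b : bool) : K2 := if b then i1 else i0.
have cE (i : K2) : i = c (i != i0) by case: (K2P i) => ->.
pose t : {perm K2} := if (s (u0, i0)).2 == i0 then 1%g else tperm i0 i1.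
have t0 : t i0 = (s (u0, i0)).2.
  by rewrite /t; case: (K2P (s (u0, i0)).2) => -> /=; rewrite ?perm1 ?tpermL.
have fib u b : (s (u, c b)).2 == t (c b).
  move: u b; apply: (@double_ind _ u0 false) => [u v b e /eqP hs|]; last by rewrite t0.
  have /graph_autP/(_ (u, c b) (v, c (~~ b))) := s_aut.
  have ne : c b != c (~~ b) by case: b {hs}.
  rewrite !product_edgeE /= e hs /complete_edge ne => /andP[_ ne_s].
  by apply/eqP; apply: (K2eq _ _ _ ne_s); rewrite (inj_eq perm_inj).
apply: (@rigid_fibre_splits _ _ s t i0 i1) => // [|u i].
  split=> [|i j]; first by rewrite card_ord.
  by case: (eqVneq i j) => [-> // | ne]; apply: connect1.
by rewrite (cE i); apply/eqP.
Qed.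

End NonBipartite.

(** * Codegrees and the starred graph *)

Definition codeg (G : sgraph) (u v : G) : nat := #|nbh u :&: nbh v|.

Lemma codegC (G : sgraph) (u v : G) : codeg u v = codeg v u.
Proof. by rewrite /codeg setIC. Qed.

Lemma codegxx (G : sgraph) (u : G) : codeg u u = deg u.
Proof. by rewrite /codeg setIid. Qed.

(** Stated with codegrees only, because these multiply in direct products and
    are preserved by isomorphisms. *)
Lemma star_edgeE (G : sgraph) (u v : G) :
  star_edge u v = [&& u != v, codeg u u == codeg v v & codeg v v == 2 * codeg u v].
Proof. by rewrite !codegxx. Qed.

Lemma codeg_product (G H : sgraph) (x y : direct_product G H) :
  codeg x y = codeg x.1 y.1 * codeg x.2 y.2.
Proof.
rewrite /codeg -cardsX; apply: eq_card => -[w l].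
by rewrite !inE !product_edgeE /= andbACA.
Qed.

Lemma deg_product (G H : sgraph) (x : direct_product G H) :
  deg x = deg x.1 * deg x.2.
Proof. by rewrite -!codegxx codeg_product. Qed.

Lemma codeg_iso (G H : sgraph) (f : G -> H) (u v : G) :
    bijective f -> (forall x y, edge (f x) (f y) = edge x y) ->
  codeg (f u) (f v) = codeg u v.
Proof.
move=> bij_f f_edge; have inj_f := bij_inj bij_f; case: bij_f => g fK gK.
rewrite /codeg -(card_imset (_ :&: _) inj_f); apply: eq_card => x.
rewrite -(gK x) mem_imset // !inE !f_edge //.
Qed.

Lemma deg_iso (G H : sgraph) (f : G -> H) (u : G) :
    bijective f -> (forall x y, edge (f x) (f y) = edge x y) ->
  deg (f u) = deg u.
Proof. by move=> bij_f f_edge; rewrite -!codegxx codeg_iso. Qed.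

Lemma codeg_thin (G : sgraph) (u v : G) :
  R_thin G -> codeg u v = deg u -> codeg u v = deg v -> u = v.
Proof.
move=> thin cu cv; apply/eqP; apply: contraT => /thin.
have /eqP <- : nbh u :&: nbh v == nbh u
  by rewrite eqEcard subsetIl -/(deg u) -cu leqnn.
by rewrite eqEcard subsetIr -/(codeg u v) cv leqnn.
Qed.

(** * Cycles from closed walks *)

Lemma closed_walk_cycle (H : sgraph) (z : nat -> H) (k : nat) :
    3 <= k -> (forall m, edge (z m) (z m.+1)) -> z k = z 0 ->
    {in gtn k &, injective z} ->
  in_cycle_of_length (z 0) k.
Proof.
move=> k3 walk closed inj; exists (mkseq z k); rewrite size_mkseq.
have k_gt0 : 0 < k by apply: leq_trans k3.
split=> //; last by apply/mapP; exists 0; rewrite ?mem_iota.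
apply/andP; split; last by apply/mkseq_uniqP.
case: k k_gt0 {k3} closed {inj} => // k _ closed.
have gen m : path (@edge H) (z m) (rcons (map z (iota m.+1 k)) (z (m.+1 + k))).
  elim: k m {closed} => [|k IH] m /=; first by rewrite addn0 walk.
  by rewrite walk -addSnnS IH.
by rewrite /= -[X in rcons _ X]closed; apply: gen.
Qed.

(** A cycle through [u] gives [u] two neighbours, so the two special clauses of
    [inL] do not apply to [u]. *)
Lemma cycle_inL (G : sgraph) (u : G) (n : nat) :
  @in_cycle_of_length (star_graph G) u n -> inL u n.
Proof.
move=> cyc; suff : 1 < @deg (star_graph G) u.
  by rewrite /inL; case: deg => [|[|d]].
case: cyc => c [c3 c_cyc uc _]; case/rot_to: uc => i c' rot_c.
have : ucycle (@edge (star_graph G)) (u :: c') by rewrite -rot_c rot_ucycle.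
have : 3 <= size (u :: c') by rewrite -rot_c size_rot.
case: c' {rot_c} => [|a [|b q]] // _ /andP[/=].
rewrite rcons_path /= => /andP[ua /andP[_ /andP[_ last_u]]].
move=> /and3P[_ /= a_notin _].
have ne : a != last b q by apply: contra a_notin => /eqP ->; apply: mem_last.
have <- : #|[set a; last b q]| = 2 by rewrite cards2 ne.
apply: subset_leq_card; apply/subsetP => x; rewrite !inE.
by case/orP => /eqP -> //; rewrite edge_sym.
Qed.

(** * Steps of length two on an even cycle *)

Section EvenCycle.
Variable k : nat.
Local Notation C := (cycle_graph (2 * k)).

Definition shift (m : nat) (i : C) : C := iter m (@ordS (2 * k)) i.

Lemma val_shift m i : val (shift m i) = (i + m) %% (2 * k).
Proof.
elim: m => [|m IH] /=; first by rewrite addn0 modn_small.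
by rewrite -/(shift m i) IH -[X in X %% _ = _]addn1 modnDml -addnA addn1.
Qed.

Lemma shiftD m1 m2 i : shift m1 (shift m2 i) = shift (m1 + m2) i.
Proof. by rewrite /shift iterD. Qed.

Lemma shift_eq m1 m2 i : (shift m1 i == shift m2 i) = (m1 == m2 %[mod 2 * k]).
Proof. by rewrite -(inj_eq val_inj) !val_shift eqn_modDl. Qed.

Lemma shiftP i j : exists m, j = shift m i.
Proof.
exists (j + (2 * k - i)); apply: val_inj; rewrite val_shift addnCA subnKC.
  by rewrite modnDr modn_small.
exact: ltnW.
Qed.

Lemma shift_inj m : injective (shift m).
Proof. by elim: m => [|m IH] // i j /ordS_inj/IH. Qed.

Lemma odd_shift m (i : C) : odd (shift m i) = odd i (+) odd m.
Proof. by rewrite val_shift odd_mod ?oddM // oddD. Qed.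

Lemma shift1_neq (i : C) : i != shift 1 i.
Proof.
apply/eqP => /(congr1 (fun j : C => odd j)); rewrite odd_shift.
by case: odd.
Qed.

Lemma cycle_edgeE (i j : C) : edge i j = (j == shift 1 i) || (i == shift 1 j).
Proof.
rewrite {1}/edge /= /cycle_edge -[X in _ && X]/((j == shift 1 i) || (i == shift 1 j)).
case: (eqVneq i j) => [-> /=|//].
by rewrite orbb (negbTE (shift1_neq j)).
Qed.

Lemma shift1_edge i : edge i (shift 1 i).
Proof. by rewrite cycle_edgeE eqxx. Qed.

Lemma cycle_edge_odd (i j : C) : edge i j -> odd i != odd j.
Proof.
by rewrite cycle_edgeE => /orP[] /eqP ->; rewrite odd_shift; case: odd.
Qed.

Lemma pred_shift i : exists h, i = shift 1 h.
Proof. by exists (ord_pred i); rewrite /shift /= ord_predK. Qed.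

Lemma nbh_shift1 h : nbh (shift 1 h : C) = [set h; shift 2 h].
Proof.
apply/setP => x; rewrite !inE cycle_edgeE shiftD orbC.
by rewrite (inj_eq (@shift_inj 1)) eq_sym.
Qed.

Definition skip (i j : C) : bool := (j == shift 2 i) || (i == shift 2 j).

Hypothesis k3 : 3 <= k.

Lemma shift_eq_small m1 m2 i :
  m1 < 6 -> m2 < 6 -> (shift m1 i == shift m2 i) = (m1 == m2).
Proof.
have le6 : 6 <= 2 * k by rewrite -[6]/(2 * 3) leq_mul2l.
by move=> lt1 lt2; rewrite shift_eq !modn_small // (leq_trans _ le6).
Qed.

Lemma skip_irr i : skip i i = false.
Proof. by rewrite /skip orbb; apply: (@shift_eq_small 0 2). Qed.

Lemma skip_sym i j : skip i j = skip j i.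
Proof. exact: orbC. Qed.

Lemma deg_cycle (i : C) : deg i = 2.
Proof.
have [h ->] := pred_shift i.
by rewrite /deg nbh_shift1 cards2 -[h in h != _]/(shift 0 h) shift_eq_small.
Qed.

Lemma common_shift2 (i : C) : nbh i :&: nbh (shift 2 i) = [set shift 1 i].
Proof.
have [h ->] := pred_shift i.
have -> : shift 2 (shift 1 h) = shift 1 (shift 2 h) by rewrite !shiftD.
rewrite !nbh_shift1 !shiftD; apply/setP => x; rewrite !inE.
apply/idP/idP => [/andP[] | /eqP ->]; last by rewrite eqxx orbT.
case/orP => [/eqP -> | /eqP -> //].
by rewrite -[X in (X == _) || _]/(shift 0 h) -[X in _ || (X == _)]/(shift 0 h)
           !shift_eq_small.
Qed.

Lemma codeg_skip (i j : C) : skip i j -> codeg i j = 1.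
Proof.
by case/orP => /eqP ->; last rewrite codegC; rewrite /codeg common_shift2 cards1.
Qed.

Lemma codeg_cycle_gt0 (i j : C) : 0 < codeg i j -> i = j \/ skip i j.
Proof.
case/card_gt0P => x; have mem l : x \in nbh l -> l \in nbh x.
  by rewrite !inE edge_sym.
case/setIP => /mem + /mem; have [h ->] := pred_shift x.
rewrite nbh_shift1 !inE /skip.
by do 2!case/orP => /eqP ->; rewrite ?eqxx ?orbT; auto.
Qed.

Lemma cycle_connected : connected_graph C.
Proof.
split=> [|i j]; first by rewrite card_ord muln_gt0 (leq_trans _ k3).
have [m ->] := shiftP i j; elim: m => [|m IH] //.
apply: connect_trans IH (connect1 _); exact: shift1_edge.
Qed.

Lemma cycle_thin : R_thin C.
Proof.
move=> i j ne; apply/negP => /eqP eqN.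
have c2 : codeg i j = 2 by rewrite /codeg -eqN setIid -/(deg i) deg_cycle.
have [eq_ij | sk] := @codeg_cycle_gt0 i j ltac:(by rewrite c2).
  by rewrite eq_ij eqxx in ne.
by rewrite codeg_skip in c2.
Qed.

(** * The starred graph of a product with an even cycle *)

Section StarProduct.
Variable G : sgraph.
Hypotheses (thinG : R_thin G) (degG : forall u : G, 0 < deg u).
Local Notation GC := (direct_product G C).

(** The starred graph of the product is the Cartesian product of [star_graph G]
    with the two [k]-cycles of steps of length 2 in [C]: as [i] and [i + 2] have
    one common neighbour in [C] instead of two, vertices over them are starred
    only if their first coordinates share all their neighbours, and are then
    equal because [G] is thin. *)
Lemma star_product_edge (x y : GC) : star_edge x y ->
  (star_edge x.1 y.1 /\ x.2 = y.2) \/ (x.1 = y.1 /\ skip x.2 y.2).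
Proof.
case: x y => [u i] [v j]; rewrite star_edgeE !codeg_product /= !codegxx !deg_cycle.
case/and3P => ne /eqP eq_d /eqP cod; have du := degG u; have dv := degG v.
have c_gt0 : 0 < codeg i j.
  apply: contraT; rewrite -eqn0Ngt => /eqP c0.
  by rewrite c0 !muln0 in cod; case: deg cod dv.
have eq_duv : deg u = deg v by apply/eqP; rewrite -(eqn_pmul2r (m := 2)) // eq_d.
have [eq_ij | sk] := codeg_cycle_gt0 c_gt0.
  left; split=> //; rewrite star_edgeE !codegxx eq_duv eqxx /=.
  rewrite -eq_ij codegxx deg_cycle in cod ne.
  apply/andP; split; first by apply: contra ne => /eqP ->.
  by rewrite -(eqn_pmul2r (m := 2)) // cod mulnA.
right; split=> //; rewrite codeg_skip // muln1 mulnC in cod.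
have {}cod : codeg u v = deg v by apply/eqP; rewrite -(eqn_pmul2l (m := 2)) // cod.
by apply: codeg_thin => //; rewrite cod.
Qed.

Lemma skip_star_product (u : G) (i j : C) :
  skip i j -> @star_edge GC (u, i) (u, j).
Proof.
move=> sk; rewrite star_edgeE !codeg_product /= !codegxx !deg_cycle codeg_skip //.
rewrite muln1 (mulnC 2 (deg u)) !eqxx !andbT.
by apply/eqP => -[eq_ij]; rewrite eq_ij skip_irr in sk.
Qed.

(** A property preserved by the automorphisms of the product. It holds for the
    ends of a path with one edge in each of the two Cartesian factors and fails
    for the ends of a two-edge path in a layer over a vertex of [G], so no
    automorphism bends such a layer. *)
Definition mixed (x y : GC) : bool :=
  ~~ star_edge x y && (0 < codeg x y).

Lemma mixedC x y : mixed x y = mixed y x.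
Proof. by rewrite /mixed star_edge_sym codegC. Qed.

Lemma mixed_product (u v : G) (i j : C) :
  star_edge u v -> skip i j -> mixed (u, i) (v, j).
Proof.
move=> uv sk; apply/andP; split.
  apply/negP => /star_product_edge[] /= [].
    by move=> _ eq_ij; rewrite eq_ij skip_irr in sk.
  by move=> eq_uv; rewrite eq_uv star_edge_irr in uv.
rewrite codeg_product /= codeg_skip // muln1.
have := degG v; move: uv; rewrite star_edgeE !codegxx => /and3P[_ _ /eqP ->].
by rewrite muln_gt0.
Qed.

Lemma unmixed_corner (x y z : GC) :
    star_edge x y -> star_edge y z -> ~~ mixed x z ->
  (x.1 == y.1) = (y.1 == z.1).
Proof.
have irr (a b : G) : star_edge a b -> (a == b) = false.
  by case: eqP => // ->; rewrite star_edge_irr.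
case: x y z => [a i] [b j] [c l].
case/star_product_edge => /= -[] => [ab <-{j} | <-{b} ij];
  case/star_product_edge => /= -[] => [bc <-{l} | <-{c} jl] unmixed.
- by rewrite !irr.
- by case/negP: unmixed; apply: mixed_product.
- case/negP: unmixed; rewrite mixedC.
  by apply: mixed_product; [rewrite star_edge_sym | rewrite skip_sym].
- by rewrite eqxx.
Qed.

(** For [k = 3] the two ends are themselves two steps apart; for larger [k] they
    have no common neighbour. *)
Lemma layer_not_mixed (u : G) (i : C) : ~~ mixed (u, i) (u, shift 4 i).
Proof.
apply/negP => /andP[/negP nstar]; rewrite codeg_product muln_gt0 => /andP[_] /=.
case/codeg_cycle_gt0 => [/eqP|sk]; last by apply: nstar; apply: skip_star_product.
by rewrite [_ == _](@shift_eq_small 0 4).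
Qed.

End StarProduct.

End EvenCycle.

(** * Dihedral automorphisms of the cycle *)

Section Dihedral.
Variable k : nat.
Local Notation C := (cycle_graph (2 * k)).

Lemma rotation (i i' : C) :
  exists2 t : {perm C}, t \in graph_aut C & forall m, t (shift m i) = shift m i'.
Proof.
have [a ->] := shiftP i i'; exists (perm (@shift_inj k a)) => [|m].
  apply/graph_autP => x y; rewrite !permE !cycle_edgeE !shiftD ![1 + a]addnC.
  by rewrite -!shiftD !(inj_eq (@shift_inj k a)).
by rewrite permE !shiftD addnC.
Qed.

Lemma shift_rev (x : C) : shift 1 (rev_ord (shift 1 x) : C) = rev_ord x.
Proof.
apply: val_inj; rewrite val_shift.
change ((2 * k - (val (shift 1 x)).+1 + 1) %% (2 * k) = 2 * k - x.+1).
rewrite val_shift !addn1.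
case: (ltngtP x.+1 (2 * k)) => [lt|gt|eq_x].
- by rewrite modn_small // -subSn ?subSS // modn_small // ltn_subrL (leq_ltn_trans _ lt).
- by have := ltn_ord x; rewrite ltnNge -ltnS gt.
- by rewrite eq_x modnn subn1 prednK -?eq_x // modnn subnn.
Qed.

Lemma reflection (i i' : C) :
  exists2 t : {perm C}, t \in graph_aut C
  & forall m, shift m (t (shift m i)) = i'.
Proof.
have rev_inj : injective (@rev_ord (2 * k) : C -> C) by exact: rev_ord_inj.
have rev_aut : perm rev_inj \in graph_aut C.
  have step x y : (rev_ord x == shift 1 (rev_ord y : C)) = (y == shift 1 x).
    have [z ->] := pred_shift y.
    by rewrite shift_rev (inj_eq rev_inj) (inj_eq (@shift_inj k 1)) eq_sym.
  by apply/graph_autP => x y; rewrite !permE !cycle_edgeE !step orbC.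
have [t t_aut tE] := rotation (rev_ord i : C) i'.
exists (perm rev_inj * t)%g; first exact: groupM.
have step x : shift 1 (t (rev_ord (shift 1 x) : C)) = t (rev_ord x : C).
  have [a eq_x] := shiftP (rev_ord i : C) (rev_ord (shift 1 x) : C).
  by rewrite -[in RHS]shift_rev eq_x shiftD !tE shiftD.
elim=> [|m IH]; first by rewrite permM permE /=; apply: (tE 0).
by rewrite -[RHS]IH !permM !permE -(step (shift m i)) shiftD addn1.
Qed.

(** A walk by steps of length 2 that never turns back keeps its direction, so a
    dihedral symmetry carries the standard such walk to it. *)
Lemma skip_walk_dihedral (j : C) (c : nat -> C) :
    (forall m, skip (c m) (c m.+1)) -> (forall m, c m != c m.+2) ->
  exists2 t : {perm C}, t \in graph_aut C & forall m, c m = t (shift m.*2 j).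
Proof.
move=> walk no_turn; pose fwd m := c m.+1 == shift 2 (c m).
have fwd_const m : fwd m = fwd 0.
  elim: m => // m <-; have := no_turn m; have := walk m; have := walk m.+1.
  rewrite /skip -/(fwd m) -/(fwd m.+1).
  case fm: (fwd m); case fm1: (fwd m.+1) => //=.
    move=> /eqP eq1 _; move: fm; rewrite /fwd eq1.
    by rewrite (inj_eq (@shift_inj k 2)) eq_sym => /eqP ->; rewrite eqxx.
  by move=> _ /eqP ->; rewrite (eqP fm1) eqxx.
case f0: (fwd 0).
  have [t t_aut tE] := rotation j (c 0); exists t => // m; rewrite tE.
  elim: m => // m IH; have /eqP -> : fwd m by rewrite fwd_const f0.
  by rewrite IH.
have [t t_aut tE] := reflection j (c 0); exists t => // m.
apply: (@shift_inj k m.*2); rewrite tE.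
elim: m => // m IH; rewrite -[RHS]IH; have := walk m.
by rewrite /skip -/(fwd m) fwd_const f0 => /eqP ->; rewrite shiftD addn2.
Qed.

End Dihedral.

(** * Stability of products with even cycles *)

Section CycleStability.
Variables (G : sgraph) (k : nat).
Hypotheses (thinG : R_thin G) (connG : connected_graph G).
Hypotheses (nbipG : ~ bipartite G) (k3 : 3 <= k).
Local Notation C := (cycle_graph (2 * k)).
Local Notation GC := (direct_product G C).

Let degG := deg_gt0 connG nbipG.

Section Automorphism.
Variable s : {perm GC}.
Hypothesis s_aut : s \in graph_aut GC.

Let s_edge := graph_autP s s_aut.
Let s_bij : bijective s := injF_bij (@perm_inj _ s).

Lemma star_aut (x y : GC) : star_edge (s x) (s y) = star_edge x y.
Proof. by rewrite !star_edgeE !(codeg_iso _ _ s_bij s_edge) (inj_eq perm_inj). Qed.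

Lemma mixed_aut (x y : GC) : mixed (s x) (s y) = mixed x y.
Proof. by rewrite /mixed star_aut (codeg_iso _ _ s_bij s_edge). Qed.

(** In the starred graph of the product, the layer over [v] through [(v, j)] is
    a [k]-cycle without mixed corners, and so is its image. Hence the image
    stays in one Cartesian factor, and this cannot be [star_graph G], where
    [u0] is on no [k]-cycle. *)
Lemma image_layer (v u0 : G) (j i0 : C) :
    ~ @in_cycle_of_length (star_graph G) u0 k -> s (v, j) = (u0, i0) ->
  exists2 t : {perm C}, t \in graph_aut C
  & forall m, s (v, shift m.*2 j) = (u0, t (shift m.*2 j)).
Proof.
move=> no_cycle s_vj; pose y m := s (v, shift m.*2 j).
have y_step m : star_edge (y m) (y m.+1).
  by rewrite star_aut; apply: skip_star_product => //; rewrite /skip eqxx.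
have y_corner m : ~~ mixed (y m) (y m.+2).
  by rewrite mixed_aut; apply: (layer_not_mixed k3 v (shift m.*2 j)).
have y_split m : (star_edge (y m).1 (y m.+1).1 /\ (y m).2 = (y m.+1).2) \/
    ((y m).1 = (y m.+1).1 /\ skip (y m).2 (y m.+1).2).
  exact: star_product_edge (y_step m).
pose flat m := (y m).1 == (y m.+1).1.
have flat_const m : flat m = flat 0.
  by elim: m => // m <-; apply/esym/unmixed_corner.
have y0 : y 0 = (u0, i0) by [].
case flat0: (flat 0); last first.
  case: no_cycle; have -> : u0 = (y 0).1 by rewrite y0.
  have y_star m : star_edge (y m).1 (y m.+1).1.
    case: (y_split m) => [[]//|[eq1 _]].
    by move: (flat_const m); rewrite flat0 /flat eq1 eqxx.
  have y2 m : (y m).2 = i0.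
    elim: m => [|m <-]; first by rewrite y0.
    case: (y_split m) => [[_ ->]//|[eq1 _]].
    by move: (flat_const m); rewrite flat0 /flat eq1 eqxx.
  apply: (@closed_walk_cycle (star_graph G) (fun m => (y m).1)) => //.
    rewrite /y; congr (s (v, _)).1; apply/eqP.
    by rewrite -[X in _ == shift _ X]/j (shift_eq k.*2 0.*2) -mul2n modnn mod0n.
  move=> a b lt_a lt_b /= eq1.
  have /perm_inj[/eqP] : y a = y b.
    by rewrite [LHS]surjective_pairing [RHS]surjective_pairing eq1 !y2.
  rewrite shift_eq -!mul2n -!muln_modr !modn_small //.
  by rewrite eqn_mul2l => /eqP.
have y1 m : (y m).1 = u0.
  elim: m => [|m <-]; first by rewrite y0.
  by apply/esym/eqP; rewrite -/(flat m) flat_const.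
have [m | m | t t_aut tE] := @skip_walk_dihedral k j (fun m => (y m).2).
- case: (y_split m) => [[st _]|[]//].
  by rewrite !y1 star_edge_irr in st.
- apply/eqP => eq2; have /perm_inj[/eqP] : y m = y m.+2.
    by rewrite [LHS]surjective_pairing [RHS]surjective_pairing eq2 !y1.
  by rewrite [_ == _](@shift_eq_small k k3 0 4 (shift m.*2 j)).
by exists t => // m; rewrite -tE -(y1 m) -surjective_pairing.
Qed.

(** The layers mapped as described by [t] spread along edges: if [w] is adjacent
    to [u], then [(w, i)] is a common neighbour of [(u, i - 1)] and
    [(u, i + 1)], and [t i] is the only common neighbour of [t (i - 1)] and
    [t (i + 1)]. The images of [(w, i)] and [(w, i + 2)] are then starred and lie
    over distinct vertices of [C], so they have the same first coordinate. *)
Lemma aut_splits (u0 : G) :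
    ~ @in_cycle_of_length (star_graph G) u0 k -> twofold_rigid G ->
  splits s.
Proof.
move=> no_cycle rigid.
have [i0 _] : exists i0 : C, i0 \in C.
  by apply/card_gt0P; case: (cycle_connected k3).
case sV: (s^-1%g (u0, i0)) => [v j].
have s_vj : s (v, j) = (u0, i0) by rewrite -sV permKV.
have [t t_aut tE] := image_layer no_cycle s_vj.
have t_edge := graph_autP _ t_aut.
have parity (i i' : C) : odd i = odd i' -> exists m, i' = shift m.*2 i.
  have [m ->] := shiftP i i'; rewrite odd_shift => eq_odd; exists m./2.
  by rewrite even_halfK //; move: eq_odd; case: (odd i); case: (odd m).
pose Q u b := [exists u', forall i : C, (odd i == b) ==> (s (u, i) == (u', t i))].
have allQ u b : Q u b.
  move: u b; apply: (double_ind connG nbipG (u0 := v) (b0 := odd j)) => [u w b uw|].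
    case/existsP => u' /forallP hu.
    have su (i : C) : odd i = b -> s (u, i) = (u', t i).
      by move=> oi; apply/eqP/(implyP (hu i)); rewrite oi.
    have sw2 (i : C) : odd i = ~~ b -> (s (w, i)).2 = t i.
      have [h ->] := pred_shift i; rewrite odd_shift addbT => /negb_inj oh.
      have nb (l : C) : odd l = b -> edge l (shift 1 h) ->
          edge (t l) (s (w, shift 1 h)).2.
        move=> ol e; have : edge ((u, l) : GC) (w, shift 1 h) by apply/andP.
        by rewrite -s_edge su // => /andP[].
      have nb0 := nb h oh (shift1_edge h).
      have nb2 : edge (t (shift 2 h)) (s (w, shift 1 h)).2.
        apply: nb; rewrite ?odd_shift ?oh ?addbF // edge_sym.
        exact: (shift1_edge (shift 1 h)).
      move: nb0 nb2; rewrite -[(s _).2](permKV t) !t_edge => nb0 nb2; congr (t _).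
      by apply/eqP; rewrite -in_set1 -(common_shift2 k3) !inE nb0.
    have [i1 oi1] : exists i1 : C, odd i1 = ~~ b.
      case: (boolP (odd i0 == ~~ b)) => [/eqP|ne]; first by exists i0.
      by exists (shift 1 i0); rewrite odd_shift addbT; case: b ne {hu su sw2}; case: odd.
    apply/existsP; exists (s (w, i1)).1; apply/forallP => i; apply/implyP => /eqP oi.
    have [m ->] := parity i1 i (etrans oi1 (esym oi)).
    have ow l : odd (shift l.*2 i1) = ~~ b by rewrite odd_shift odd_double addbF.
    rewrite [s _]surjective_pairing sw2 //; apply/eqP; congr (_, _).
    elim: m => // m <-; have : star_edge (s (w, shift m.*2 i1)) (s (w, shift m.+1.*2 i1)).
      by rewrite star_aut; apply: skip_star_product => //; rewrite /skip eqxx.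
    case/(star_product_edge k3 thinG degG) => [[_]|[-> //]].
    rewrite !sw2 // => /perm_inj/eqP.
    by rewrite [_ == _](@shift_eq_small k k3 0 2 (shift m.*2 i1)).
  apply/existsP; exists u0; apply/forallP => i; apply/implyP => /eqP oi.
  by have [m ->] := parity j i (esym oi); rewrite tE.
apply: (rigid_fibre_splits rigid (cycle_connected k3) (shift1_edge i0) s_aut t_aut).
move=> u i; have /existsP[u' /forallP/(_ i)] := allQ u (odd i).
by rewrite eqxx => /eqP ->.
Qed.

End Automorphism.

Lemma rigid_stable_cycle (u0 : G) :
    ~ @in_cycle_of_length (star_graph G) u0 k -> twofold_rigid G ->
  stable G C.
Proof.
move=> no_cycle rigid; have [i0 _] : exists i0 : C, i0 \in C.
  by apply/card_gt0P; case: (cycle_connected k3).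
apply/(stableP u0 i0) => s s_aut.
exact: (aut_splits s_aut no_cycle rigid).
Qed.

End CycleStability.

(** * Coprimality with an even cycle *)

(** Colour each vertex by whether it precedes its only neighbour in a fixed
    enumeration of the vertices. *)
Lemma deg1_bipartite (D : sgraph) : (forall d : D, deg d = 1) -> bipartite D.
Proof.
move=> deg1; pose f (d : D) := [forall e, edge d e ==> (enum_rank d < enum_rank e)].
have fE (d e : D) : edge d e -> f d = (enum_rank d < enum_rank e).
  move=> de; have /cards1P[x Nd] : #|nbh d| == 1 by rewrite -/(deg d) deg1.
  have only l : edge d l = (l == x) by rewrite -in_set1 -Nd inE.
  move: (de); rewrite only => /eqP ->; apply/forallP/idP => [/(_ x)|lt l].
    by rewrite only eqxx.
  by rewrite only; apply/implyP => /eqP ->.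
exists f => d e de; have ed : edge e d by rewrite edge_sym.
rewrite (fE d e de) (fE e d ed).
have : enum_rank d != enum_rank e :> nat.
  rewrite (inj_eq val_inj) (inj_eq enum_rank_inj).
  by apply: contraTneq de => ->; rewrite edge_irr.
by rewrite neq_ltn; case: ltngtP.
Qed.

(** A common factor [D] is non-bipartite because [G] is, so it cannot be
    1-regular; comparing degrees in the cycle, [D] is 2-regular and the other
    factor of the cycle is 1-regular. Every second vertex of the cycle then
    has the same first coordinate, so every vertex of [D] lies on a closed walk
    of [k] distinct vertices whose consecutive members have one common neighbour.
    Lifted to a copy of [D] in [G], this is a [k]-cycle of [star_graph G] through
    any given vertex. *)
Lemma coprime_cycle (G : sgraph) (k : nat) (u0 : G) :
    3 <= k -> ~ bipartite G ->
    ~ @in_cycle_of_length (star_graph G) u0 k ->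
  coprime_graphs G (cycle_graph (2 * k)).
Proof.
move=> k3 nbipG no_cycle [D [_ [G' [g g_bij g_edge]] [H' [h h_bij h_edge]]]].
have nbipD : ~ bipartite D.
  move=> [f fP]; apply: nbipG; exists (fun u => f (g u).2) => u v.
  by rewrite -g_edge => /andP[_ /fP].
have [h' hK h'K] := h_bij; have [g' gK g'K] := g_bij.
have [i1 _] : exists i : cycle_graph (2 * k), i \in cycle_graph (2 * k).
  by apply/card_gt0P; case: (cycle_connected k3).
pose a0 : H' := (h i1).1.
have deg2 (a : H') (d : D) : deg a * deg d = 2.
  rewrite -(deg_cycle k3 (h' (a, d))) -(deg_iso _ h_bij h_edge) h'K.
  by rewrite deg_product.
have degD (d : D) : deg d = 2.
  apply/eqP; apply: contraT => ne; case: nbipD; apply: deg1_bipartite.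
  have : deg d %| 2 by rewrite -(deg2 a0 d) dvdn_mull.
  case/(primeP (isT : prime 2)).2/orP => /eqP d1; last by rewrite d1 in ne.
  move=> e; have := deg2 a0 d; rewrite d1 muln1 => a0_2.
  by apply/eqP; rewrite -(eqn_pmul2l (m := 2)) // -{1}a0_2 deg2.
have degH (a : H') : deg a = 1.
  by apply/eqP; rewrite -(eqn_pmul2r (m := 2)) // -{1}(degD (g u0).2) deg2.
pose x := (g u0).1.
pose i0 := h' (a0, (g u0).2).
pose y m := h (shift m.*2 i0).
have y_fst m : (y m).1 = a0.
  elim: m => [|m <-]; first by rewrite /y /= h'K.
  have near (i : cycle_graph (2 * k)) : edge (h (shift 1 i)).1 (h i).1
                                     /\ edge (h (shift 1 i)).1 (h (shift 2 i)).1.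
    have e1 := shift1_edge i; have e2 := shift1_edge (shift 1 i).
    rewrite -h_edge edge_sym in e1; rewrite -h_edge in e2.
    by case/andP: e1; case/andP: e2.
  have [] := near (shift m.*2 i0); rewrite -/(y m) -/(y m.+1).
  have /cards1P[b Nb] : #|nbh (h (shift 1 (shift m.*2 i0))).1| == 1.
    by rewrite -/(deg _) degH.
  by rewrite -!in_set -!/(nbh _) Nb !in_set1 => /eqP -> /eqP ->.
have y_cod m : codeg (y m).2 (y m.+1).2 = 1.
  have : codeg (y m) (y m.+1) = 1.
    by rewrite (codeg_iso _ _ h_bij h_edge) codeg_skip // /skip eqxx.
  by rewrite codeg_product !y_fst codegxx degH mul1n.
have y_inj m n : (y m).2 = (y n).2 -> m.*2 = n.*2 %[mod 2 * k].
  move=> eq2; apply/eqP; rewrite -(shift_eq m.*2 n.*2 i0); apply/eqP.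
  apply: (bij_inj h_bij); rewrite -/(y m) -/(y n).
  by rewrite [LHS]surjective_pairing [RHS]surjective_pairing eq2 !y_fst.
pose z m : G := g' (x, (y m).2).
have gz m : g (z m) = (x, (y m).2) by rewrite g'K.
apply: no_cycle; have -> : u0 = z 0.
  by rewrite /z /y /= h'K -surjective_pairing gK.
apply: (@closed_walk_cycle (star_graph G) z) => //.
- move=> m; rewrite /= star_edgeE; apply/and3P.
  rewrite -!(codeg_iso _ _ g_bij g_edge) !gz !codeg_product /= !codegxx !degD.
  rewrite y_cod muln1 mulnC !eqxx; split=> //.
  apply/eqP => eq_z; have := y_cod m.
  have [->] : (x, (y m).2) = (x, (y m.+1).2) by rewrite -!gz eq_z.
  by rewrite codegxx degD.
- rewrite /z /y; congr (g' (x, (h _).2)); apply/eqP.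
  by rewrite -[X in _ == X]/(shift 0 i0) (shift_eq k.*2 0) -mul2n modnn mod0n.
move=> m n lt_m lt_n eq_z.
have : (y m).2 = (y n).2.
  by have [] : (x, (y m).2) = (x, (y n).2) by rewrite -!gz eq_z.
move/y_inj; rewrite -!mul2n -!muln_modr !modn_small //.
by move/eqP; rewrite eqn_mul2l => /eqP.
Qed.

Lemma stable_cycle_K2 (G : sgraph) (k : nat) :
    connected_graph G -> ~ bipartite G -> 0 < k ->
  stable G (cycle_graph (2 * k)) -> stable G K2.
Proof.
move=> connG nbipG k_gt0 stab; apply: rigid_stable_K2 => //.
have [i _] : exists i : cycle_graph (2 * k), i \in cycle_graph (2 * k).
  by apply/card_gt0P; rewrite card_ord muln_gt0.
exact: (stable_bipartite_rigid (@cycle_edge_odd k) (shift1_edge i)).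
Qed.

Lemma compatible_even (G : sgraph) (k : nat) :
    3 <= k -> compatible G (2 * k) ->
  exists u : G, ~ @in_cycle_of_length (star_graph G) u k.
Proof.
move=> k3 [_ [[]|[_ [u nL]]]]; first by rewrite oddM.
by exists u => /cycle_inL; rewrite -[k]doubleK -mul2n.
Qed.

Theorem theorem1p3 (G : sgraph) (thinG : R_thin G)
    (connG : connected_graph G) (nbipG : ~ bipartite G) :
  [/\ unstable G K2 <->
        (forall k : nat, 2 <= k -> unstable G (cycle_graph (2 * k))),
      (forall k : nat, 3 <= k -> compatible G (2 * k) ->
        (nontrivially_unstable G (cycle_graph (2 * k)) <-> unstable G K2))
    & (exists k : nat, [/\ 3 <= k, compatible G (2 * k)
        & nontrivially_unstable G (cycle_graph (2 * k))]) ->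
      forall l : nat, 3 <= l -> unstable G (cycle_graph (2 * l))].
Proof.
have up k : 2 <= k -> unstable G K2 -> unstable G (cycle_graph (2 * k)).
  by move=> k2; apply: contra; apply: stable_cycle_K2 => //; apply: ltnW.
have down k (u : G) : 3 <= k -> ~ @in_cycle_of_length (star_graph G) u k ->
    unstable G (cycle_graph (2 * k)) -> unstable G K2.
  move=> k3 no_cycle; apply: contra => stab.
  apply: (rigid_stable_cycle thinG connG nbipG k3 no_cycle).
  apply: (@stable_bipartite_rigid G K2 (fun i => i == ord0) ord0 ord_max) stab => //.
  by do 2!case=> -[|[|//]] ?.
have b k : 3 <= k -> compatible G (2 * k) ->
    (nontrivially_unstable G (cycle_graph (2 * k)) <-> unstable G K2).
  move=> k3 /(compatible_even k3)[u no_cycle]; split=> [[unst _ _ _ _] | unst].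
    exact: down no_cycle unst.
  split; [exact: up (ltnW k3) unst | | | exact: coprime_cycle no_cycle | by left].
    by split=> //; apply: cycle_thin.
  by split=> //; apply: cycle_connected.
split=> // [|[k [k3 comp /(b k k3 comp) unst]] l l3].
  split=> [unst k k2|unst]; first exact: up.
  have [u _] : exists u : G, u \in G by apply/card_gt0P; case: connG.
  (* No cycle of [star_graph G] is longer than the number of vertices. *)
  have k3 : 3 <= #|G| + 3 by rewrite leq_addl.
  apply: (@down _ u k3); last by apply: unst; apply: ltnW.
  case=> c [_ /andP[_ uniq_c] _ size_c].
  have := max_card (mem c); rewrite (card_uniqP uniq_c) size_c.
  by rewrite leqNgt -{1}[#|_|]addn0 ltn_add2l.
exact: up (ltnW l3) unst.
Qed.
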